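(* Let $\Pi^{(2)}$ be the set of $3$-nonnesting open partition diagrams, and to each $\pi\in\Pi^{(2)}$ associate the label $\ell(\pi)=[i,j]$, where $i$ is the number of semi-arcs of $\pi$ and $j$ is the number of semi-arcs of $\pi$ that belong to some future $2$-nesting of $\pi$. Consider the generating tree with root label $[0,0]$ and succession rule \[ [i,j]\rightarrow \begin{cases} [i,j] & \text{(always)},\\ [i+1,j] & \text{(always)},\\ [i,m] \text{ for each } m \text{ with } j\le m\le i-1 & \text{if } i\ge 1,\\ [i-1,m] \text{ for each } m \text{ with } j\le m\le i-1 & \text{if } i\ge 1,\\ [i,j-1],\ [i-1,j-1] & \text{if } i\ge 1 \text{ and } j>0. \end{cases} \] Then for every $n\ge 0$, the number of diagrams in $\Pi^{(2)}$ of size $n$ equals the number of nodes at level $n$ of this generating tree. Moreover, the number of $3$-nonnesting set partitions of $\{1,\dots,n\}$ is equal to the number of nodes with label $[0,0]$ at level $n$.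
   Context: An open partition diagram of size $n\ge 0$ consists of vertices $1,\dots,n$ placed in a row, together with a set of arcs $(a,b)$ with $1\le a<b\le n$ and a set of semi-arcs $(a,* )$ with $1\le a\le n$ (a semi-arc has a left end-point but no right end-point; it is drawn continuing to the right of vertex $n$, semi-arcs not crossing one another), such that every vertex is the left end-point of at most one arc or semi-arc and the right end-point of at most one arc. Equivalently, it is a set partition of $\{1,\dots,n\}$ in which each block is marked ''closed'' or ''open'': a block $\{a_1<\dots<a_r\}$ contributes the arcs $(a_1,a_2),\dots,(a_{r-1},a_r)$, and, if marked open, also the semi-arc $(a_r,* )$. A set partition of $\{1,\dots,n\}$ is identified with the open partition diagram having no semi-arcs. A $k$-nesting is a set of $k$ arcs $(i_1,j_1),\dots,(i_k,j_k)$ with $i_1<i_2<\dots<i_k<j_k<\dots<j_1$. A future $k$-nesting is a $(k-1)$-nesting $(i_2,j_2),\dots,(i_k,j_k)$ together with a semi-arc $(i_1,* )$ with $i_1<i_2$. An open partition diagram is $k$-nonnesting if it contains neither a $k$-nesting nor a future $k$-nesting. A generating tree with root label $L_0$ and a succession rule (assigning to each label a finite list of labels, with multiplicity) is the rooted tree whose root, at level $0$, has label $L_0$, and in which each node with label $L$ has exactly one child for each entry of the list assigned to $L$, labelled by that entry; level $n$ consists of the nodes at distance $n$ from the root. *)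

(* Defs.v *)
From mathcomp Require Import all_boot.

Set Implicit Arguments.
Unset Strict Implicit.
Unset Printing Implicit Defensive.

(* The vertices 1, ..., n are represented by the elements 0, ..., n - 1 of     *)
(* 'I_n. A diagram is a pair (arcs, semi-arcs); the semi-arc (a, * ) is        *)
(* represented by its left end-point a.                                        *)
Notation diagram n := ({set 'I_n * 'I_n} * {set 'I_n})%type.

Section Diagram.

Variable n : nat.
Implicit Types (d : diagram n) (s : seq ('I_n * 'I_n)).

Definition arcs d : {set 'I_n * 'I_n} := d.1.
Definition semi_arcs d : {set 'I_n} := d.2.

Definition is_open_partition_diagram d : bool :=
  [&& [forall e in arcs d, e.1 < e.2],
      [forall a : 'I_n, #|[set b | (a, b) \in arcs d]| + (a \in semi_arcs d) <= 1]
    & [forall b : 'I_n, #|[set a | (a, b) \in arcs d]| <= 1]].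

(* [:: (i_1, j_1); ...; (i_k, j_k)] |-> [:: i_1; ...; i_k; j_k; ...; j_1]      *)
Definition endpoints s : seq nat :=
  [seq val e.1 | e <- s] ++ rev [seq val e.2 | e <- s].

Definition is_nesting d s : bool :=
  all [in arcs d] s && sorted ltn (endpoints s).

Definition has_nesting d (k : nat) : bool :=
  [exists s : k.-tuple ('I_n * 'I_n), is_nesting d s].

(* The semi-arc (a, * ) together with the nesting s, all of whose arcs start   *)
(* to the right of a.                                                          *)
Definition is_future_nesting d (a : 'I_n) s : bool :=
  [&& a \in semi_arcs d, all [in arcs d] s & path ltn a (endpoints s)].

Definition in_future_nesting d (k : nat) (a : 'I_n) : bool :=
  [exists s : k.-1.-tuple ('I_n * 'I_n), is_future_nesting d a s].

Definition has_future_nesting d (k : nat) : bool :=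
  [exists a : 'I_n, in_future_nesting d k a].

Definition nonnesting (k : nat) d : bool :=
  ~~ has_nesting d k && ~~ has_future_nesting d k.

Definition diagram_label d : nat * nat :=
  (#|semi_arcs d|, #|[set a in semi_arcs d | in_future_nesting d 2 a]|).

(* The diagram identified with a set partition: its arcs join consecutive      *)
(* elements of a block, and it has no semi-arcs.                               *)
Definition diagram_of_partition (P : {set {set 'I_n}}) : diagram n :=
  ([set e : 'I_n * 'I_n |
      [exists B in P, [&& e.1 \in B, e.2 \in B, e.1 < e.2
                        & [forall c in B, ~~ (e.1 < c < e.2)]]]],
   set0).

End Diagram.

Definition open_diagrams3 (n : nat) : {set diagram n} :=
  [set d : diagram n | is_open_partition_diagram d && nonnesting 3 d].

Definition set_partitions3 (n : nat) : {set {set {set 'I_n}}} :=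
  [set P : {set {set 'I_n}} |
    partition P [set: 'I_n] && nonnesting 3 (diagram_of_partition P)].

(* The labels of the nodes at level n of a generating tree, with one entry for *)
(* each node; nodes are therefore counted by size and count_mem.               *)
Fixpoint tree_level (T : Type) (root : T) (rule : T -> seq T) (n : nat) : seq T :=
  if n is m.+1 then flatten [seq rule L | L <- tree_level root rule m]
  else [:: root].

(* index_iota j i enumerates the m such that j <= m <= i - 1.                  *)
Definition rule3 (L : nat * nat) : seq (nat * nat) :=
  let: (i, j) := L in
  [:: (i, j); (i.+1, j)]
  ++ (if 1 <= i then [seq (i, m) | m <- index_iota j i] else [::])
  ++ (if 1 <= i then [seq (i.-1, m) | m <- index_iota j i] else [::])
  ++ (if (1 <= i) && (0 < j) then [:: (i, j.-1); (i.-1, j.-1)] else [::]).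

(* Main.v *)
(* Deleting the vertex n + 1 from a diagram of size n + 1, and turning the arc *)
(* ending there (if any) into a semi-arc, gives a diagram of size n; so a      *)
(* diagram of size n + 1 arises from one of size n by closing at most one      *)
(* semi-arc at n + 1 and possibly opening a new one there.  A semi-arc belongs *)
(* to a future 2-nesting iff some arc starts to its right, so the j such       *)
(* semi-arcs are the j leftmost ones.  Closing a semi-arc that has r semi-arcs *)
(* to its left keeps the diagram 3-nonnesting iff r = 0 or j <= r: otherwise   *)
(* the new arc, together with an arc inside it, forms a 2-nesting to the right *)
(* of another semi-arc.  The new value of j is r if j <= r, and j - 1 if       *)
(* r = 0 < j.  Set partitions correspond to the diagrams without semi-arcs:    *)
(* the blocks are the connected components of the arcs, which are increasing   *)
(* chains since every vertex has at most one arc on either side.               *)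

Require Import Defs.
From mathcomp Require Import all_boot zify.

Set Implicit Arguments.
Unset Strict Implicit.
Unset Printing Implicit Defensive.

(** Deleting the last vertex makes the diagrams themselves a generating tree, and the label of a
    diagram determines the multiset of labels of its children. Treating semi-arcs as arcs ending at
    [n] merges the two forbidden patterns into one ([nonnesting3P]). A diagram of size [n.+1] is
    then a diagram of size [n] plus the choice of a semi-arc to close, if any, and of whether the
    new vertex opens one; [extend_inj], [extend_open_diagram3] and [restrict_open_diagram3] show
    that the admissible choices produce each diagram exactly once ([perm_open_diagrams3]).

    Rank the semi-arcs from left to right, starting at 0. By [before_arcE], those with an arc to
    their right are the ones of rank below [j], so which ranks may be closed, and with which
    resulting label, depends on [i,j] alone ([extend_label], [perm_extension_labels]). Induction on
    the size matches the labels with a level of the tree ([perm_labels]).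

    For the second claim, label [0,0] means that there is no semi-arc. The arcs then form disjoint
    increasing chains whose vertex sets are the blocks, and joining consecutive elements of each
    block recovers the arcs ([card_set_partitions3]). *)

Section GeneralizedArcs.

Variable n : nat.
Implicit Types (d : diagram n) (x y u v : nat).

(** * Diagrams as relations on natural numbers *)

Lemma ltn_ordE x : x < n -> exists a : 'I_n, x = a.
Proof. by move=> lt_xn; exists (Ordinal lt_xn). Qed.

Lemma leq_ordE x : x <= n -> x = n \/ exists a : 'I_n, x = a.
Proof. by rewrite leq_eqVlt => /orP[/eqP|/ltn_ordE]; [left | right]. Qed.

(* A semi-arc is seen as an arc ending at [n]: a future nesting is then a      *)
(* nesting whose outer arc ends at [n].                                        *)
Definition gen_arc d x y : bool :=
  [exists e in arcs d, (val e.1 == x) && (val e.2 == y)]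
  || (y == n) && [exists a in semi_arcs d, val a == x].

Lemma gen_arcE d (a b : 'I_n) : gen_arc d a b = ((a, b) \in arcs d).
Proof.
rewrite /gen_arc (ltn_eqF (ltn_ord b)) orbF.
apply/exists_inP/idP => [[[a' b'] /= d_e /andP[/eqP/val_inj<- /eqP/val_inj<-]] //|].
by exists (a, b); rewrite //= !eqxx.
Qed.

Lemma gen_arc_semi d (a : 'I_n) : gen_arc d a n = (a \in semi_arcs d).
Proof.
rewrite /gen_arc eqxx /=; apply/orP/idP => [[]|da].
- case/exists_inP => -[a' b] /= _ /andP[_ /eqP].
  by move/eqP; rewrite (ltn_eqF (ltn_ord b)).
- by case/exists_inP => a' da /eqP/val_inj<-.
by right; apply/exists_inP; exists a.
Qed.

Lemma gen_arc_bound d x y : gen_arc d x y -> x < n /\ y <= n.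
Proof.
case/orP => [/exists_inP[[a b] /= _ /andP[/eqP<- /eqP<-]]|].
  by split; [exact: ltn_ord | exact/ltnW/ltn_ord].
by case/andP => /eqP-> /exists_inP[a _ /eqP<-]; split; first exact: ltn_ord.
Qed.

Lemma gen_arc_inj d d' :
  (forall x y, x < n -> y <= n -> gen_arc d x y = gen_arc d' x y) -> d = d'.
Proof.
move=> eq_dd'; case: d d' eq_dd' => [A S] [A' S'] eq_dd'; congr (_, _).
  by apply/setP => -[a b]; have := eq_dd' a b (ltn_ord a) (ltnW (ltn_ord b));
     rewrite !gen_arcE.
by apply/setP => a; have := eq_dd' a n (ltn_ord a) (leqnn n); rewrite !gen_arc_semi.
Qed.

Definition diagram_of_rel (g : rel nat) : diagram n :=
  ([set e : 'I_n * 'I_n | g e.1 e.2], [set a : 'I_n | g a n]).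

Lemma gen_arc_of_rel (g : rel nat) x y :
  gen_arc (diagram_of_rel g) x y = [&& x < n, y <= n & g x y].
Proof.
case: (ltnP x n) => [lt_xn|le_nx] /=; last first.
  by apply/negP => /gen_arc_bound[]; lia.
have [a ->] := ltn_ordE lt_xn.
case: (ltngtP y n) => [/ltn_ordE[b ->]|lt_ny|->] /=.
- by rewrite gen_arcE inE.
- by apply/negP => /gen_arc_bound[]; lia.
by rewrite gen_arc_semi inE.
Qed.

(** Uniqueness of the left end is required only for [y < n], since many semi-arcs may end at [n]; a
    vertex with both an arc and a semi-arc violates uniqueness of the right end. *)
Lemma open_partition_diagramP d :
  reflect [/\ forall x y, gen_arc d x y -> x < y,
              forall x y y', gen_arc d x y -> gen_arc d x y' -> y = y'
            & forall x x' y, y < n ->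
                gen_arc d x y -> gen_arc d x' y -> x = x']
          (is_open_partition_diagram d).
Proof.
apply: (iffP and3P) => [[/forall_inP lt_d /forallP out_d /forallP in_d]|
                        [lt_d out_d in_d]].
- split=> [x y dxy|x y y' dxy dxy'|x x' y lt_yn dxy dx'y].
  + have [/ltn_ordE[a Ex] le_yn] := gen_arc_bound dxy; rewrite {x}Ex in dxy *.
    case: (leq_ordE le_yn) => [->|[b Ey]]; first exact: ltn_ord.
    by rewrite {y le_yn}Ey gen_arcE in dxy *; exact: (lt_d _ dxy).
  + have [/ltn_ordE[a Ex] le_yn] := gen_arc_bound dxy.
    have [_ le_y'n] := gen_arc_bound dxy'.
    rewrite {x}Ex in dxy dxy'; have := out_d a.
    case: (leq_ordE le_yn) (leq_ordE le_y'n) => [Ey|[b Ey]] [Ey'|[b' Ey']];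
      rewrite {y le_yn}Ey {y' le_y'n}Ey' in dxy dxy' * => //.
    * rewrite gen_arc_semi in dxy; rewrite gen_arcE in dxy'.
      by rewrite dxy (cardsD1 b') inE dxy' addn1 ltnS leqn0 addn_eq0.
    * rewrite gen_arc_semi in dxy'; rewrite gen_arcE in dxy.
      by rewrite dxy' (cardsD1 b) inE dxy addn1 ltnS leqn0 addn_eq0.
    rewrite !gen_arcE in dxy dxy' => le1.
    have /card_le1_eqP card1 := leq_trans (leq_addr _ _) le1.
    by rewrite (card1 b b') ?inE.
  have [/ltn_ordE[a Ex] _] := gen_arc_bound dxy.
  have [/ltn_ordE[a' Ex'] _] := gen_arc_bound dx'y.
  have [b Ey] := ltn_ordE lt_yn.
  rewrite {x}Ex {x'}Ex' {y lt_yn}Ey !gen_arcE in dxy dx'y *.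
  by have /card_le1_eqP card1 := in_d b; rewrite (card1 a a') ?inE.
split.
- by apply/forall_inP => -[a b] /=; rewrite -gen_arcE => /lt_d.
- apply/forallP => a; case: (boolP (a \in _)) => [|_]; last first.
    rewrite addn0; apply/card_le1_eqP => b b'; rewrite !inE -!gen_arcE => dab dab'.
    by apply: val_inj; exact: out_d dab' dab.
  rewrite -gen_arc_semi => dan; rewrite (_ : [set b | _] = set0) ?cards0 //.
  apply/setP => b; rewrite !inE -gen_arcE; apply/negP => dab.
  by have := out_d _ _ _ dan dab; have := ltn_ord b; lia.
apply/forallP => b; apply/card_le1_eqP => a a'; rewrite !inE -!gen_arcE => dab da'b.
by apply: val_inj; exact: in_d (ltn_ord b) da'b dab.
Qed.

(** As [y2 < y1 <= n], only the outer arc can be a semi-arc: [y1 = n] gives a future 3-nesting,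
    [y1 < n] a 3-nesting. *)
Lemma nonnesting3P d :
  reflect (forall x1 x2 x3 y3 y2 y1,
             gen_arc d x1 y1 -> gen_arc d x2 y2 -> gen_arc d x3 y3 ->
             ~ [/\ x1 < x2, x2 < x3, x3 < y3, y3 < y2 & y2 < y1])
          (nonnesting 3 d).
Proof.
apply: (iffP andP) => [[no_nest no_future] x1 x2 x3 y3 y2 y1|no_nest].
  move=> d1 d2 d3 [lt1 lt2 lt3 lt4 lt5].
  have [/ltn_ordE[a1 E1] le_y1n] := gen_arc_bound d1.
  have [/ltn_ordE[a2 E2] _] := gen_arc_bound d2.
  have [/ltn_ordE[a3 E3] _] := gen_arc_bound d3.
  have [b2 Ey2] := ltn_ordE (leq_trans lt5 le_y1n).
  have [b3 Ey3] := ltn_ordE (ltn_trans lt4 (leq_trans lt5 le_y1n)).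
  subst; rewrite !gen_arcE in d2 d3.
  case: (leq_ordE le_y1n) => [E|[b1 E]]; subst.
    case/negP: no_future; apply/existsP; exists a1.
    apply/existsP; exists [tuple (a2, b2); (a3, b3)].
    by rewrite /is_future_nesting -gen_arc_semi /= d1 d2 d3 lt1 lt2 lt3 lt4.
  rewrite gen_arcE in d1.
  case/negP: no_nest; apply/existsP; exists [tuple (a1, b1); (a2, b2); (a3, b3)].
  by rewrite /is_nesting /= d1 d2 d3 lt1 lt2 lt3 lt4 lt5.
split; apply/negP.
  case/existsP; case/tupleP => -[a1 b1]; case/tupleP => -[a2 b2].
  case/tupleP => -[a3 b3] t; rewrite (tuple0 t) /is_nesting /= !andbT -!gen_arcE.
  case/and4P => /and3P[d1 d2 d3] lt1 lt2 /and3P[lt3 lt4 lt5].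
  exact: (no_nest _ _ _ _ _ _ d1 d2 d3).
case/existsP => a1; case/existsP; case/tupleP => -[a2 b2].
case/tupleP => -[a3 b3] t; rewrite (tuple0 t) /is_future_nesting /= !andbT.
rewrite -gen_arc_semi -!gen_arcE.
case/and5P => d1 /andP[d2 d3] lt1 lt2 /andP[lt3 lt4].
exact: (no_nest _ _ _ _ _ _ d1 d2 d3).
Qed.

(** For a semi-arc at [x], this is membership in a future 2-nesting; see [in_future_nesting2]. *)
Definition before_arc d x : bool := [exists e in arcs d, x < e.1 < e.2].

Lemma before_arcP d x :
  reflect (exists u v, [/\ gen_arc d u v, x < u, u < v & v < n]) (before_arc d x).
Proof.
apply: (iffP exists_inP) => [[[a b] /= dab /andP[lt_xa lt_ab]]|
                              [u [v [duv lt_xu lt_uv lt_vn]]]].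
  by exists a, b; rewrite gen_arcE.
have [lt_un _] := gen_arc_bound duv.
exists (Ordinal lt_un, Ordinal lt_vn); last by rewrite /= lt_xu.
by rewrite -gen_arcE.
Qed.

Lemma in_future_nesting2 d (a : 'I_n) :
  in_future_nesting d 2 a = (a \in semi_arcs d) && before_arc d a.
Proof.
apply/existsP/andP => [[t]|[da /exists_inP[e de lt_ae]]].
  case/tupleP: t => e t; rewrite (tuple0 t) /is_future_nesting /= !andbT.
  case/and4P => da de lt1 lt2; split=> //.
  by apply/exists_inP; exists e; rewrite ?lt1.
by exists [tuple e]; rewrite /is_future_nesting /= da de !andbT.
Qed.

Lemma card_ord_count (p : pred nat) : #|[set a : 'I_n | p a]| = count p (iota 0 n).
Proof.
rewrite cardsE cardE size_filter -val_enum_ord count_map enumT.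
exact: eq_count.
Qed.

(** The rank of a semi-arc at [x], counted from the left starting at 0. *)
Definition semi_before d x : nat := count (gen_arc d ^~ n) (iota 0 x).

Lemma diagram_labelE d :
  diagram_label d = (semi_before d n,
    count (fun x => gen_arc d x n && before_arc d x) (iota 0 n)).
Proof.
rewrite /diagram_label /semi_before -!card_ord_count; congr (_, _); apply: eq_card => a.
  by rewrite !inE gen_arc_semi.
by rewrite !inE in_future_nesting2 gen_arc_semi andbA andbb.
Qed.

End GeneralizedArcs.

(** Used with [p] the semi-arcs: choosing a semi-arc becomes choosing a rank below [i]. *)
Lemma count_before_iota (p : pred nat) n :
  [seq count p (iota 0 x) | x <- iota 0 n & p x] = iota 0 (count p (iota 0 n)).
Proof.
elim: n => // n IHn; rewrite -addn1 iotaD filter_cat map_cat IHn count_cat /= add0n.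
by case: (p n) => /=; rewrite ?addn0 ?cats0 // iotaD.
Qed.

(** * Adding and deleting the last vertex *)

Section Extension.

Variable n : nat.
Implicit Types (d : diagram n) (e : diagram n.+1) (c : option nat) (b : bool).

(* The new vertex [n] ends the arc started by the semi-arc [x] when            *)
(* [c = Some x], and starts a semi-arc when [b] holds.                         *)
Definition extend d c b : diagram n.+1 :=
  diagram_of_rel n.+1 (fun x y =>
    if y < n then gen_arc d x y
    else if y == n then c == Some x
    else (gen_arc d x n && (c != Some x)) || b && (x == n)).

Definition restrict e : diagram n :=
  diagram_of_rel n (fun x y => gen_arc e x y || (y == n) && gen_arc e x n.+1).

(** If an arc lies to the right of [x], the closing arc encloses it, and a semi-arc further left
    would complete a 3-nesting; hence rank 0 is required. *)
Definition closable d (x : nat) : bool :=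
  gen_arc d x n && (before_arc d x ==> (semi_before d x == 0)).

Definition extensions d : seq (diagram n.+1) :=
  [seq extend d c b | b <- [:: false; true],
                      c <- None :: [seq Some x | x <- iota 0 n & closable d x]].

Lemma extend_arc d c b x y : y < n -> gen_arc (extend d c b) x y = gen_arc d x y.
Proof.
move=> lt_yn; rewrite gen_arc_of_rel lt_yn (leq_trans (ltnW lt_yn)) //=.
by case: ltnP => // le_nx; apply/esym/negP => /gen_arc_bound[]; lia.
Qed.

Lemma extend_new_arc d c b x : gen_arc (extend d c b) x n = (x <= n) && (c == Some x).
Proof. by rewrite gen_arc_of_rel ltnn eqxx ltnS leqnSn. Qed.

Lemma extend_semi d c b x :
  gen_arc (extend d c b) x n.+1 = gen_arc d x n && (c != Some x) || b && (x == n).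
Proof.
rewrite gen_arc_of_rel leqnn (ltnNge n.+1 n) (leqnSn n) gtn_eqF //= ltnS.
case: leqP => // lt_nx; apply/esym/negP => /orP[/andP[/gen_arc_bound[]]|]; lia.
Qed.

Lemma restrict_arc e x y : y < n -> gen_arc (restrict e) x y = (x < n) && gen_arc e x y.
Proof. by move=> lt_yn; rewrite gen_arc_of_rel (ltnW lt_yn) ltn_eqF // orbF. Qed.

Lemma restrict_semi e x :
  gen_arc (restrict e) x n = (x < n) && (gen_arc e x n || gen_arc e x n.+1).
Proof. by rewrite gen_arc_of_rel leqnn eqxx. Qed.

Lemma semi_before_eq0P d x :
  reflect (forall y, gen_arc d y n -> x <= y) (semi_before d x == 0).
Proof.
rewrite -leqn0 leqNgt -has_count.
apply: (iffP hasPn) => no_semi y; last first.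
  by rewrite mem_iota /= add0n => lt_yx; apply/negP => /no_semi; rewrite leqNgt lt_yx.
rewrite leqNgt => dy; apply/negP => lt_yx.
by have := no_semi y; rewrite mem_iota /= dy => /(_ lt_yx).
Qed.

Lemma mem_extensions d e :
  reflect (exists c b, e = extend d c b /\ forall x, c = Some x -> closable d x)
          (e \in extensions d).
Proof.
apply: (iffP allpairsP) => [[[b c] /= [_ dc ->]]|[c [b [-> dc]]]].
  exists c, b; split=> // x Ec; move: dc; rewrite {}Ec inE /=.
  by case/mapP => y; rewrite mem_filter => /andP[dy _] [->].
exists (b, c); split=> //=; first by case: b.
case: c dc => [x /(_ _ erefl) dx|_]; last by rewrite mem_head.
rewrite inE map_f // mem_filter dx mem_iota.
by case/andP: dx => /gen_arc_bound[].
Qed.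

(** [c] is read off the arc ending at the new vertex, [b] off its semi-arc, and [d] off the rest.
    Closability guarantees that the closed semi-arc is present in both diagrams. *)
Lemma extend_inj d1 c1 b1 d2 c2 b2 :
  (forall x, c1 = Some x -> closable d1 x) ->
  (forall x, c2 = Some x -> closable d2 x) ->
  extend d1 c1 b1 = extend d2 c2 b2 -> [/\ d1 = d2, c1 = c2 & b1 = b2].
Proof.
have closable_lt d x : closable d x -> x < n by case/andP => /gen_arc_bound[].
move=> dc1 dc2 eq_ext.
have eq_c : c1 = c2.
  have eq_new x : (x <= n) && (c1 == Some x) = (x <= n) && (c2 == Some x).
    by rewrite -(extend_new_arc d1 c1 b1) eq_ext extend_new_arc.
  case: c1 c2 dc1 dc2 eq_new {eq_ext} => [x|] [y|] dc1 dc2 eq_new //.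
  - have := eq_new x; rewrite eqxx (ltnW (closable_lt _ _ (dc1 _ erefl))).
    by move/esym/eqP.
  - by have := eq_new x; rewrite eqxx (ltnW (closable_lt _ _ (dc1 _ erefl))).
  by have := eq_new y; rewrite eqxx (ltnW (closable_lt _ _ (dc2 _ erefl))).
subst c2; split=> //; last first.
  have semi_n d : gen_arc d n n = false by apply/negP => /gen_arc_bound[]; lia.
  have := extend_semi d1 c1 b1 n; rewrite eq_ext extend_semi !semi_n eqxx !andbT.
  by [].
apply: gen_arc_inj => x y lt_xn; rewrite leq_eqVlt => /orP[/eqP->|lt_yn].
  case: (c1 =P Some x) => [Ec|/eqP ne_c].
    by have /andP[-> _] := dc1 _ Ec; have /andP[-> _] := dc2 _ Ec.
  have := extend_semi d1 c1 b1 x; rewrite eq_ext extend_semi ne_c.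
  by rewrite (ltn_eqF lt_xn) !andbF !andbT !orbF => ->.
by rewrite -(extend_arc _ c1 b1) // eq_ext extend_arc.
Qed.

(** In a 3-nesting of the extension the inner arc is old. If the middle arc is old too, [d] already
    has a 3-nesting. Otherwise the middle arc is the closing one and has an arc to its right, so it
    started as the leftmost semi-arc, contrary to the outer arc. *)
Lemma extend_open_diagram3 d c b :
  d \in open_diagrams3 n -> (forall x, c = Some x -> closable d x) ->
  extend d c b \in open_diagrams3 n.+1.
Proof.
rewrite !inE => /andP[/open_partition_diagramP[lt_d out_d in_d] /nonnesting3P no_nest].
move=> dc.
(* In this order: an old arc, the closing arc, a surviving semi-arc, the new semi-arc. *)
have extP x y : gen_arc (extend d c b) x y ->
    [\/ y < n /\ gen_arc d x y,
        [/\ y = n, c = Some x, gen_arc d x n & before_arc d x ==> (semi_before d x == 0)],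
        [/\ y = n.+1, c <> Some x & gen_arc d x n]
      | [/\ y = n.+1, b = true & x = n]].
  move=> dxy; have [_] := gen_arc_bound dxy; rewrite leq_eqVlt ltnS.
  case/orP => [/eqP Ey|]; last rewrite leq_eqVlt => /orP[/eqP Ey|lt_yn].
  - rewrite Ey extend_semi in dxy; case/orP: dxy => [/andP[dxn /eqP]|/andP[-> /eqP]].
      by constructor 3.
    by constructor 4.
  - rewrite Ey extend_new_arc in dxy; case/andP: dxy => _ /eqP Ec.
    by have /andP[] := dc _ Ec; constructor 2.
  by constructor 1; rewrite extend_arc in dxy.
apply/andP; split.
  apply/open_partition_diagramP; split.
  - by move=> x y /extP[[_ /lt_d]|[-> _ /lt_d]|[-> _ /lt_d]|[-> _ ->]] //; lia.
  - move=> x y y' /extP dxy /extP dxy'.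
    have semi_n : ~ gen_arc d n n by move=> /lt_d; lia.
    case: dxy => [[lt_yn dxy]|[-> cx dx _]|[-> cx dx]|[-> bt Ex]];
    case: dxy' => [[lt_y'n dxy']|[-> cx' dx' _]|[-> cx' dx']|[-> bt' Ex']] //;
    try by [have := out_d _ _ _ dxy dxy' | have := out_d _ _ _ dxy dx'; lia
           | have := out_d _ _ _ dx dxy'; lia
           | have [] := gen_arc_bound dxy; lia | have [] := gen_arc_bound dxy'; lia
           | have [] := gen_arc_bound dx; lia | have [] := gen_arc_bound dx'; lia].
  move=> x x' y; rewrite ltnS => le_yn /extP dxy /extP dx'y.
  case: dxy => [[lt_yn dxy]|[Ey cx _ _]|[Ey _ _]|[Ey _ _]]; try lia;
    case: dx'y => [[lt_y'n dxy']|[Ey' cx' _ _]|[Ey' _ _]|[Ey' _ _]]; try lia.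
    exact: in_d dxy dxy'.
  by case: cx' cx => -> [].
apply/nonnesting3P => x1 x2 x3 y3 y2 y1 /extP d1 /extP d2 /extP d3 [lt1 lt2 lt3 lt4 lt5].
have {}d3 : gen_arc d x3 y3 by case: d3 => -[] //; case: d1 => -[]; lia.
(* The new semi-arc starts at [n], too far right to be the outer arc. *)
have {d1} [[lt_y1n d1]|[le_ny1 d1]] :
    y1 < n /\ gen_arc d x1 y1 \/ n <= y1 <= n.+1 /\ gen_arc d x1 n.
- case: d1 => [|[-> _ dx _]|[-> _ dx]|[Ey1 _ Ex1]]; [by left | by right; split; lia.. |].
  by have := lt_d _ _ d3; have [] := gen_arc_bound d3; lia.
- case: d2 => [[_ d2]|[]|[]|[]]; try lia.
  exact: (no_nest _ _ _ _ _ _ d1 d2 d3).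
case: d2 => [[lt_y2n d2]|[Ey2 _ d2 d2_first]|[]|[]]; try lia.
  exact: (no_nest _ _ _ _ _ _ d1 d2 d3).
have /(implyP d2_first)/semi_before_eq0P/(_ _ d1) : before_arc d x2; last by lia.
by apply/before_arcP; exists x3, y3; split=> //; lia.
Qed.

(** In a nesting of the restriction, an outer arc ending at [n] comes from one of [e] ending at [n]
    or [n.+1], still beyond the other ends. The reopened semi-arc is closable, since a semi-arc on
    its left and an arc on its right would form a 3-nesting of [e] around the closing arc. *)
Lemma restrict_open_diagram3 e :
  e \in open_diagrams3 n.+1 ->
  restrict e \in open_diagrams3 n /\ e \in extensions (restrict e).
Proof.
rewrite !inE => /andP[/open_partition_diagramP[lt_e out_e in_e] /nonnesting3P no_nest].
have resP x y : gen_arc (restrict e) x y -> x < n /\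
    (y < n /\ gen_arc e x y \/ y = n /\ exists z, n <= z <= n.+1 /\ gen_arc e x z).
  move=> dxy; have [lt_xn] := gen_arc_bound dxy; rewrite leq_eqVlt => /orP[/eqP Ey|lt_yn].
    move: dxy; rewrite Ey restrict_semi => /andP[_ /orP[exn|exn]];
      split=> //; right; split=> //.
      by exists n; split => //; lia.
    by exists n.+1; split => //; lia.
  by rewrite restrict_arc // lt_xn in dxy; split=> //; left.
split.
  apply/andP; split.
    apply/open_partition_diagramP; split.
    - by move=> x y /resP[lt_xn [[_ /lt_e]|[-> _]]].
    - move=> x y y' /resP[lt_xn dxy] /resP[_ dxy'].
      case: dxy => [[lt_yn exy]|[-> [z [lt_nz exz]]]];
      case: dxy' => [[lt_y'n exy']|[-> [z' [lt_nz' exz']]]] //.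
      + exact: out_e exy exy'.
      + by have := out_e _ _ _ exy exz'; lia.
      by have := out_e _ _ _ exz exy'; lia.
    move=> x x' y lt_yn /resP[_ [[_ exy]|]]; last lia.
    move=> /resP[_ [[_ ex'y]|]]; last lia.
    by apply: in_e exy ex'y; lia.
  apply/nonnesting3P => x1 x2 x3 y3 y2 y1 d1 d2 d3 [lt1 lt2 lt3 lt4 lt5].
  have [_ le_y1n] := gen_arc_bound d1.
  case/resP: d2 => _ [[_ d2]|]; last lia.
  case/resP: d3 => _ [[_ d3]|]; last lia.
  case/resP: d1 => _ [[_ d1]|[_ [z [lt_nz d1]]]].
    exact: (no_nest _ _ _ _ _ _ d1 d2 d3).
  by apply: (no_nest _ _ _ _ _ _ d1 d2 d3); split=> //; lia.
apply/mem_extensions.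
pose c := if [pick x : 'I_n | gen_arc e x n] is Some x then Some (val x) else None.
have cP x : (c == Some x) = gen_arc e x n.
  rewrite /c; case: pickP => [a ean|no_arc].
    apply/eqP/idP => [[<-] //|exn]; congr Some.
    exact: in_e ean exn.
  apply/esym/negP => exn; have lt_xn := lt_e _ _ exn.
  by have := no_arc (Ordinal lt_xn); rewrite /= exn.
exists c, (gen_arc e n n.+1); split.
  apply: gen_arc_inj => x y; rewrite ltnS => le_xn; rewrite leq_eqVlt.
  case/orP => [/eqP->|]; last rewrite ltnS leq_eqVlt => /orP[/eqP->|lt_yn].
  - rewrite extend_semi restrict_semi cP.
    case: (ltngtP x n) le_xn => // [lt_xn _|->]; last first.
      by rewrite andbT /=.
    rewrite andbF orbF /=; case: (boolP (gen_arc e x n)) => [exn|_]; last first.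
      by rewrite andbT.
    by apply/negP => exn1; have := out_e _ _ _ exn exn1; lia.
  - by rewrite extend_new_arc cP le_xn.
  rewrite extend_arc // restrict_arc //.
  by case: ltnP => // le_nx; apply/negP => /lt_e; lia.
move=> x /eqP; rewrite cP => exn; have lt_xn := lt_e _ _ exn.
rewrite /closable restrict_semi lt_xn exn /=; apply/implyP => /before_arcP[u [v]].
case=> duv lt_xu lt_uv lt_vn; apply/semi_before_eq0P => x1 /resP[lt_x1n]; case; first lia.
case=> _ [z [lt_z ex1z]]; rewrite leqNgt; apply/negP => lt_x1x.
case/resP: duv => _ [[_ euv]|]; last lia.
(* Either two arcs end at the new vertex, or there is a 3-nesting. *)
have [Ez|Ez] : z = n \/ z = n.+1 by lia.
  by subst z; have := in_e _ _ _ (ltnSn n) exn ex1z; lia.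
by apply: (no_nest _ _ _ _ _ _ ex1z exn euv); split=> //; lia.
Qed.

Lemma closable_options d c :
  c \in None :: [seq Some x | x <- iota 0 n & closable d x] ->
  forall x, c = Some x -> closable d x.
Proof.
move=> dc x Ec; move: dc; rewrite {}Ec inE /=.
by case/mapP => y; rewrite mem_filter => /andP[dy _] [->].
Qed.

Lemma extensions_uniq d : uniq (extensions d).
Proof.
apply: allpairs_uniq => //.
  rewrite /= map_inj_uniq ?filter_uniq ?iota_uniq //; last by move=> x y [].
  by rewrite andbT; apply/mapP => -[].
move=> _ _ /allpairsPdep[b1 [c1 [_ dc1 ->]]] /allpairsPdep[b2 [c2 [_ dc2 ->]]] /=.
by case/extend_inj; [exact: closable_options.. | move=> _ -> ->].
Qed.

Lemma perm_open_diagrams3 :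
  perm_eq (enum (open_diagrams3 n.+1))
          (flatten [seq extensions d | d <- enum (open_diagrams3 n)]).
Proof.
apply: uniq_perm; first exact: enum_uniq.
  (* By [extend_inj], distinct diagrams have disjoint lists of extensions. *)
  elim: (enum _) (enum_uniq (open_diagrams3 n)) => // d s IHs.
  rewrite cons_uniq => /andP[s'd /IHs uniq_s].
  rewrite -[flatten _]/(extensions d ++ flatten (map extensions s)).
  rewrite cat_uniq extensions_uniq uniq_s andbT andTb.
  apply/hasPn => e /flatten_mapP[d2 sd2 /mem_extensions[c2 [b2 [-> dc2]]]].
  apply/negP => /mem_extensions[c1 [b1 [eq_ext dc1]]].
  have [eq_d _ _] := extend_inj dc2 dc1 eq_ext.
  by rewrite -eq_d sd2 in s'd.
move=> e; rewrite mem_enum; apply/idP/flatten_mapP => [/restrict_open_diagram3[de ee]|].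
  by exists (restrict e); rewrite ?mem_enum.
case=> d; rewrite mem_enum => dd /mem_extensions[c [b [-> dc]]].
exact: extend_open_diagram3.
Qed.

(** * Labels of the extensions *)

Definition future_count d : nat :=
  count (fun x => gen_arc d x n && before_arc d x) (iota 0 n).

Lemma before_arc_trans d x y : x <= y -> before_arc d y -> before_arc d x.
Proof.
move=> le_xy /before_arcP[u [v [duv lt_yu lt_uv lt_vn]]].
by apply/before_arcP; exists u, v; split=> //; exact: leq_ltn_trans lt_yu.
Qed.

Lemma future_count_le d : future_count d <= semi_before d n.
Proof. by apply: sub_count => x /andP[]. Qed.

Lemma count_ltn_iota (p : pred nat) x m :
  x <= m -> count (fun y => p y && (y < x)) (iota 0 m) = count p (iota 0 x).
Proof.
move=> le_xm; rewrite -(subnKC le_xm) iotaD count_cat add0n.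
rewrite [X in _ + X](eq_in_count (a2 := pred0)) ?count_pred0 ?addn0.
  by apply: eq_in_count => y; rewrite mem_iota /= add0n => ->; rewrite andbT.
by move=> y; rewrite mem_iota => /andP[le_xy _]; rewrite /= ltnNge le_xy andbF.
Qed.

Lemma count_neq_iota (p : pred nat) x m :
  x < m -> p x -> count (fun y => p y && (Some x != Some y)) (iota 0 m) =
                  (count p (iota 0 m)).-1.
Proof.
move=> lt_xm px; rewrite -[in RHS]size_filter -[in RHS](count_predC (pred1 x)).
rewrite count_uniq_mem ?filter_uniq ?iota_uniq // mem_filter px mem_iota lt_xm /=.
rewrite count_filter; apply: eq_count => y /=; rewrite andbC eq_sym; congr (~~ _ && _).
Qed.

(** Having an arc to the right is inherited by points further left, so it holds on an initial
    segment of the semi-arcs. *)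
Lemma before_arcE d x :
  (forall u v, gen_arc d u v -> u < v) ->
  gen_arc d x n -> before_arc d x = (semi_before d x < future_count d).
Proof.
move=> lt_d dx; have lt_xn := lt_d _ _ dx.
case: (boolP (before_arc d x)) => [bx|nbx]; apply/esym.
  have -> : future_count d = semi_before d x + (1 + count
      (fun y => gen_arc d y n && before_arc d y) (iota x.+1 (n - x.+1))); last by lia.
  rewrite /future_count [iota 0 n](_ : _ = iota 0 x ++ x :: iota x.+1 (n - x.+1));
    last first.
    by rewrite -[x :: _]/(iota x (n - x.+1).+1) -iotaD; congr iota; lia.
  rewrite count_cat /= dx bx; congr (_ + _); apply: eq_in_count => y.
  by rewrite mem_iota /= add0n => lt_yx; rewrite (before_arc_trans (ltnW lt_yx) bx) andbT.
apply/negbTE; rewrite -leqNgt /semi_before -(count_ltn_iota _ (ltnW lt_xn)).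
apply: sub_count => y /andP[dy]; rewrite dy ltnNge; apply: contraL.
by move=> le_xy; apply: contra nbx; exact: before_arc_trans.
Qed.

Lemma before_arc_extend d c b x :
  (forall u v, gen_arc d u v -> u < v) ->
  (forall y, c = Some y -> gen_arc d y n) ->
  before_arc (extend d c b) x =
  before_arc d x || (if c is Some y then x < y else false).
Proof.
move=> lt_d dc; apply/before_arcP/orP.
  case=> u [v [duv lt_xu lt_uv]]; rewrite ltnS leq_eqVlt => /orP[/eqP Ev|lt_vn].
    by rewrite Ev extend_new_arc in duv; case/andP: duv => _ /eqP->; right.
  by left; apply/before_arcP; exists u, v; rewrite extend_arc in duv.
case=> [/before_arcP[u [v [duv lt_xu lt_uv lt_vn]]]|].
  by exists u, v; rewrite extend_arc //; split=> //; exact: ltnW.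
case: c dc => // y /(_ _ erefl)/lt_d lt_yn lt_xy.
by exists y, n; rewrite extend_new_arc eqxx ltnW.
Qed.

(** Closing [x] gives an arc to the right of exactly the points left of [x]. If [x] already had an
    arc to its right, so had these, and only [x] is lost; otherwise the qualifying semi-arcs are
    those left of [x]. The new vertex has no arc to its right. *)
Lemma extend_label d c b :
  d \in open_diagrams3 n -> (forall x, c = Some x -> closable d x) ->
  diagram_label (extend d c b) =
    (semi_before d n - (c != None) + b,
     if c is Some x then
       if semi_before d x < future_count d then (future_count d).-1 else semi_before d x
     else future_count d).
Proof.
rewrite inE => /andP[/open_partition_diagramP[lt_d _ _] _] dc.
have {}dc x : c = Some x -> gen_arc d x n by case/dc/andP.
have semi_n : gen_arc d n n = false by apply/negP => /lt_d; lia.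
have iotaE : iota 0 n.+1 = iota 0 n ++ [:: n] by rewrite -addn1 iotaD.
rewrite diagram_labelE; congr (_, _).
  rewrite /semi_before iotaE count_cat /= addn0 extend_semi.
  rewrite semi_n eqxx andbT /=; congr (_ + _).
  rewrite (eq_in_count (a2 := fun y => gen_arc d y n && (c != Some y))); last first.
    move=> y; rewrite mem_iota /= => lt_yn.
    by rewrite extend_semi (ltn_eqF lt_yn) andbF orbF.
  case: c dc => [x|] dc /=; last by rewrite subn0; apply: eq_count => y; rewrite andbT.
  by rewrite subn1 -(@count_neq_iota _ x) ?dc ?lt_d // dc.
rewrite iotaE count_cat /= addn0 extend_semi.
have -> : before_arc (extend d c b) n = false.
  by apply/before_arcP => -[u [v []]]; lia.
rewrite andbF addn0.
rewrite (eq_in_count (a2 := fun y => [&& gen_arc d y n, c != Some y &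
            before_arc d y || (if c is Some x then y < x else false)])); last first.
  move=> y; rewrite mem_iota /= => lt_yn.
  by rewrite extend_semi before_arc_extend // (ltn_eqF lt_yn) andbF orbF andbA.
case: c dc => [x|] dc /=; last by apply: eq_count => y; rewrite orbF.
have dx := dc _ erefl; rewrite -before_arcE //.
case: ifP => bx.
  rewrite -(@count_neq_iota _ x) ?lt_d ?dx //.
  apply: eq_count => y /=; rewrite -!andbA; congr (_ && _); rewrite andbC.
  by case: ltnP => [lt_yx|]; rewrite ?orbF ?(before_arc_trans (ltnW lt_yx) bx).
rewrite /semi_before -(count_ltn_iota _ (ltnW (lt_d _ _ dx))).
apply: eq_count => y /=; congr (_ && _).
case: (ltngtP y x) => [lt_yx|lt_xy|->]; rewrite ?eqxx ?orbT ?andbT //.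
- by apply/eqP => -[]; lia.
by rewrite orbF; apply/negP => /andP[_] /(before_arc_trans (ltnW lt_xy)); rewrite bx.
Qed.

Lemma perm_extension_labels d :
  d \in open_diagrams3 n ->
  perm_eq [seq diagram_label e | e <- extensions d] (rule3 (diagram_label d)).
Proof.
move=> dd; rewrite diagram_labelE -/(future_count d).
have := future_count_le d.
have lt_d : forall u v, gen_arc d u v -> u < v.
  by move: dd; rewrite inE => /andP[/open_partition_diagramP[]].
(* Below, [rs] lists the ranks of the closable semi-arcs, and closing rank [r] turns [j] into
   [f r]. *)
set i := semi_before d n; set j := future_count d => le_ji.
pose f r := if r < j then j.-1 else r.
pose rs := [seq r <- iota 0 i | (r < j) ==> (r == 0)].
have ext_b b : [seq diagram_label (extend d c b)
               | c <- None :: [seq Some x | x <- iota 0 n & closable d x]] =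
               (i + b, j) :: [seq (i.-1 + b, f r) | r <- rs].
  rewrite map_cons extend_label // subn0; congr (_ :: _).
  have -> : rs = map (semi_before d) [seq x <- iota 0 n | closable d x].
    rewrite /rs -[iota 0 i]count_before_iota filter_map -filter_predI; congr map.
    apply: eq_filter => x; rewrite /closable /= andbC.
    by case: (boolP (gen_arc d x n)) => // dx; rewrite before_arcE.
  rewrite -!map_comp; apply/eq_in_map => x; rewrite mem_filter => /andP[dx _].
  by rewrite /= extend_label ?subn1 // => _ [<-].
have rsE (k : nat) : [seq (k, f r) | r <- rs] =
    (if (0 < i) && (0 < j) then [:: (k, j.-1)] else [::])
    ++ [seq (k, m) | m <- index_iota j i].
  rewrite /rs /f /index_iota; case: (posnP j) => [->|j_gt0].
    by rewrite andbF subn0 filter_predT.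
  (* Below [j] only rank 0 survives, sent by [f] to [j.-1]; from [j] on, every rank survives and [f]
     fixes it. *)
  rewrite (leq_trans j_gt0 le_ji) -{1}(subnKC le_ji) iotaD filter_cat map_cat add0n.
  congr (_ ++ _).
    rewrite -(prednK j_gt0) /= (eq_in_filter (a2 := pred0)) ?filter_pred0 //.
    by move=> r; rewrite mem_iota => ?; apply/negbTE; rewrite negb_imply; lia.
  rewrite (eq_in_filter (a2 := predT)) ?filter_predT.
    by apply/eq_in_map => r; rewrite mem_iota => /andP[le_jr _]; rewrite ltnNge le_jr.
  by move=> r; rewrite mem_iota => /andP[le_jr _]; rewrite ltnNge le_jr.
pose cs := None :: [seq Some x | x <- iota 0 n & closable d x].
have -> : [seq diagram_label e | e <- extensions d] =
    [seq diagram_label (extend d c false) | c <- cs]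
    ++ [seq diagram_label (extend d c true) | c <- cs].
  by rewrite /extensions map_allpairs -/cs /= cats0.
rewrite /cs !ext_b !rsE.
(* The rule lists these labels in another order, so multiplicities are compared. *)
apply/permP => P; rewrite /rule3 addn0 addn1.
case: (posnP i) => [->|i_gt0]; first by rewrite /index_iota sub0n /=; lia.
rewrite /= !count_cat /= !count_cat /= addn0 addn1 (prednK i_gt0).
by case: (0 < j) => /=; lia.
Qed.

End Extension.

(** The induction needs all labels, not just their number, since the children of a node depend on
    its label. *)
Lemma perm_labels n :
  perm_eq [seq diagram_label d | d <- enum (open_diagrams3 n)]
          (tree_level (0, 0) rule3 n).
Proof.
elim: n => [|n IHn].
  pose d0 : diagram 0 := (set0, set0).
  have all_d0 (d : diagram 0) : d = d0 by apply: gen_arc_inj.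
  have perm_d0 : perm_eq (enum (open_diagrams3 0)) [:: d0].
    apply: uniq_perm => // [|d]; first exact: enum_uniq.
    rewrite mem_enum (all_d0 d) mem_head inE; apply/andP; split.
      by apply/open_partition_diagramP; split=> // [x y|x y y'] /gen_arc_bound[].
    by apply/nonnesting3P => x1 x2 x3 y3 y2 y1 /gen_arc_bound[].
  by have := perm_map (@diagram_label 0) perm_d0; rewrite /= diagram_labelE.
apply: perm_trans (perm_map _ (perm_open_diagrams3 n)) _ => /=.
have := perm_flatten (perm_map rule3 IHn); rewrite -map_comp; apply: perm_trans.
rewrite map_flatten -map_comp.
have: {subset enum (open_diagrams3 n) <= open_diagrams3 n} by move=> d; rewrite mem_enum.
elim: (enum _) => // d s IHs sub_s.
have dd : d \in open_diagrams3 n by rewrite sub_s ?mem_head.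
apply: (perm_cat (perm_extension_labels dd) (IHs _)) => e se.
by rewrite sub_s // inE se orbT.
Qed.

(** * Set partitions as diagrams without semi-arcs *)

Lemma connect_functional (T : finType) (e : rel T) x y z :
  (forall x y z, e x y -> e x z -> y = z) ->
  connect e x y -> connect e x z -> connect e y z || connect e z y.
Proof.
move=> fun_e /connectP[p]; elim: p x => [|x' p IHp] x /=; first by move=> _ -> ->.
case/andP => exx' px' Ey /connectP[[|x'' q] /= qx Ez].
  by rewrite Ez; apply/orP; right; apply/connectP; exists (x' :: p); rewrite //= exx'.
case/andP: qx => exx''; rewrite -(fun_e _ _ _ exx' exx'') => qx'.
apply: (IHp x') => //; apply/connectP; exists q => //.
by rewrite (fun_e _ _ _ exx' exx'').
Qed.

Section Partitions.

Variable n : nat.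
Implicit Types (d : diagram n) (P : {set {set 'I_n}}) (a b c : 'I_n).

Definition arc d : rel 'I_n := fun a b => (a, b) \in arcs d.

(** On disjoint chains, two vertices share a component exactly when one is reachable from the
    other. *)
Definition same_block d : rel 'I_n :=
  fun a b => connect (arc d) a b || connect (arc d) b a.

Definition partition_of_diagram d : {set {set 'I_n}} :=
  equivalence_partition (same_block d) [set: 'I_n].

Lemma connect_arc_le d a b : is_open_partition_diagram d -> connect (arc d) a b -> a <= b.
Proof.
case/open_partition_diagramP => lt_d _ _ /connectP[p].
elim: p a => [|c p IHp] a /=; first by move=> _ ->.
case/andP; rewrite /arc -gen_arcE => /lt_d lt_ac pc Eb.
exact: leq_trans (ltnW lt_ac) (IHp _ pc Eb).
Qed.

(** Arcs are functional in both directions, so two vertices reached from a common one, or reaching a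
    common one, are comparable; this yields transitivity. *)
Lemma same_block_equivalence d :
  is_open_partition_diagram d -> equivalence_rel (same_block d).
Proof.
case/open_partition_diagramP => lt_d out_d in_d.
have out_arc a b c : arc d a b -> arc d a c -> b = c.
  by rewrite /arc -!gen_arcE => dab dac; apply: val_inj; exact: out_d dab dac.
have in_arc a b c : arc d b a -> arc d c a -> b = c.
  rewrite /arc -!gen_arcE => dab dac; apply: val_inj.
  exact: in_d (ltn_ord a) dab dac.
have symR : symmetric (same_block d) by move=> a b; rewrite /same_block orbC.
apply/equivalence_relP; split; first by move=> a; rewrite /same_block connect0.
apply: sym_left_transitive => // b a c /orP[ab|ba] /orP[bc|cb].
- by rewrite /same_block (connect_trans ab bc).
- have := @connect_functional _ [rel x y | arc d y x] b a c in_arc.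
  by rewrite !connect_rev /= orbC; exact.
- exact: connect_functional out_arc ba bc.
by rewrite /same_block (connect_trans cb ba) orbT.
Qed.

Lemma partition_of_diagramP d :
  is_open_partition_diagram d -> partition (partition_of_diagram d) [set: 'I_n].
Proof.
move=> open_d; apply: equivalence_partitionP => a b c _ _ _.
exact: same_block_equivalence.
Qed.

Lemma pblock_partition_of_diagram d a b :
  is_open_partition_diagram d ->
  (b \in pblock (partition_of_diagram d) a) = same_block d a b.
Proof.
move=> open_d; apply: pblock_equivalence_partition; rewrite ?inE //.
by move=> x y z _ _ _; exact: same_block_equivalence.
Qed.

Lemma arc_of_partition P a b :
  partition P [set: 'I_n] ->
  ((a, b) \in arcs (diagram_of_partition P)) =
    [&& b \in pblock P a, a < b & [forall c in pblock P a, ~~ (a < c < b)]].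
Proof.
case/and3P => /eqP cover_P tr_P _; rewrite inE /=.
apply/exists_inP/idP => [[B PB /and4P[aB bB lt_ab no_c]]|/and3P[ba lt_ab no_c]].
  by rewrite (def_pblock tr_P PB aB) bB lt_ab.
have aP : a \in cover P by rewrite cover_P inE.
by exists (pblock P a); rewrite ?pblock_mem // mem_pblock aP ba lt_ab.
Qed.

Lemma diagram_of_partition_open P :
  partition P [set: 'I_n] -> is_open_partition_diagram (diagram_of_partition P).
Proof.
move=> partP; have arcP := arc_of_partition _ _ partP.
have [_ tr_P _] := and3P partP.
apply/and3P; split.
- by apply/forall_inP => -[a b]; rewrite arcP => /and3P[].
- apply/forallP => a; rewrite inE addn0; apply/card_le1_eqP => b b'.
  rewrite inE arcP inE arcP => /and3P[ab lt_ab no_b] /and3P[ab' lt_ab' no_b'].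
  have := forall_inP no_b _ ab'; have := forall_inP no_b' _ ab; rewrite lt_ab lt_ab' /=.
  by rewrite -!leqNgt => le1 le2; apply/esym/val_inj/eqP; rewrite eqn_leq le1 le2.
apply/forallP => b; apply/card_le1_eqP => a a'.
rewrite inE arcP inE arcP => /and3P[ab lt_ab no_a] /and3P[a'b lt_a'b no_a'].
have Eab := same_pblock tr_P ab; have Ea'b := same_pblock tr_P a'b.
have aP x : x \in pblock P x by rewrite mem_pblock (cover_partition partP) inE.
have := forall_inP no_a a'; rewrite -Eab Ea'b aP => /(_ isT).
have := forall_inP no_a' a; rewrite -Ea'b Eab aP => /(_ isT).
rewrite lt_ab lt_a'b !andbT -!leqNgt => le1 le2.
by apply/esym/val_inj/eqP; rewrite eqn_leq le1 le2.
Qed.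

(** Arcs stay inside a block, and passing repeatedly to the next element reaches every later one. *)
Lemma same_block_diagram_of_partition P a b :
  partition P [set: 'I_n] ->
  same_block (diagram_of_partition P) a b = (b \in pblock P a).
Proof.
move=> partP; have arcP := arc_of_partition _ _ partP.
have [_ tr_P _] := and3P partP.
have memP x : x \in pblock P x by rewrite mem_pblock (cover_partition partP) inE.
have symP x y : (y \in pblock P x) = (x \in pblock P y).
  by apply/idP/idP => /(same_pblock tr_P) ->.
have connect_mem x y : connect (arc (diagram_of_partition P)) x y -> y \in pblock P x.
  case/connectP => p; elim: p x => [|z p IHp] x /=; first by move=> _ ->.
  rewrite /arc arcP => /andP[/and3P[xz _ _] pz] Ey.
  by rewrite -(same_pblock tr_P xz); exact: IHp.
have mem_connect m (x y : 'I_n) : y - x < m -> x <= y -> y \in pblock P x ->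
    connect (arc (diagram_of_partition P)) x y.
  elim: m x => // m IHm x lt_m; rewrite leq_eqVlt => /orP[/eqP/val_inj-> //|lt_xy xy].
  have y_ok : (y \in pblock P x) && (x < y) by rewrite xy.
  (* The next element [z] of the block after [x] is at most [y], so the distance to [y] drops. *)
  case: (@arg_minnP _ y (fun z => (z \in pblock P x) && (x < z)) val y_ok).
  move=> z /andP[xz lt_xz] min_z; apply: (connect_trans (connect1 (y := z) _)).
    rewrite /arc arcP xz lt_xz; apply/forall_inP => w xw.
    apply/negP => /andP[lt_xw lt_wz].
    by have := min_z w; rewrite xw lt_xw => /(_ isT); rewrite leqNgt lt_wz.
  have le_zy : z <= y by exact: min_z.
  by apply: IHm; rewrite ?(same_pblock tr_P xz) //; lia.
apply/orP/idP => [[/connect_mem //|/connect_mem]|ab]; first by rewrite symP.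
by case: (leqP a b) => [le_ab|/ltnW le_ba]; [left | right];
  apply: mem_connect (ltnSn _) _ _; rewrite // symP.
Qed.

Lemma diagram_of_partitionK P :
  partition P [set: 'I_n] -> partition_of_diagram (diagram_of_partition P) = P.
Proof.
move=> partP; rewrite -[RHS](equivalence_partition_pblock partP).
apply: eq_imset => a; apply/setP => b.
by rewrite !inE same_block_diagram_of_partition.
Qed.

(** Since arcs increase, any larger element of the block of [x] is reached through the only arc
    leaving [x]; nothing in the block can therefore lie strictly under that arc. *)
Lemma partition_of_diagramK d :
  is_open_partition_diagram d -> semi_arcs d = set0 ->
  diagram_of_partition (partition_of_diagram d) = d.
Proof.
move=> open_d no_semi; rewrite [RHS]surjective_pairing -/(semi_arcs d) no_semi.
congr (_, _); apply/setP => -[a b].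
have := arc_of_partition a b (partition_of_diagramP open_d).
move=> ->; rewrite pblock_partition_of_diagram //.
have [lt_d out_d _] := open_partition_diagramP _ open_d.
have step (x y : 'I_n) :
    x < y -> same_block d x y -> exists2 z, arc d x z & connect (arc d) z y.
  move=> lt_xy /orP[/connectP[[|z p] /= pz Ey]|/(connect_arc_le open_d)].
  - by rewrite Ey ltnn in lt_xy.
  - by case/andP: pz => xz pz; exists z => //; apply/connectP; exists p.
  by rewrite leqNgt lt_xy.
apply/and3P/idP => [[ab lt_ab /forall_inP no_c]|dab].
  have [c ac cb] := step _ _ lt_ab ab.
  have lt_ac : a < c by apply: lt_d; rewrite gen_arcE.
  have := no_c c; rewrite pblock_partition_of_diagram // /same_block connect1 //.
  move=> /(_ isT); rewrite lt_ac /= -leqNgt => le_bc.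
  have le_cb := connect_arc_le open_d cb.
  by rewrite (_ : b = c) //; apply: val_inj; apply/eqP; rewrite eqn_leq le_bc.
have lt_ab : a < b by apply: lt_d; rewrite gen_arcE.
split=> //; first by rewrite /same_block connect1.
apply/forall_inP => c; rewrite pblock_partition_of_diagram // => ac.
apply/negP => /andP[lt_ac lt_cb]; have [z az zc] := step _ _ lt_ac ac.
have Ez : val z = val b.
  by apply: (out_d a); rewrite gen_arcE.
by have := connect_arc_le open_d zc; move: Ez => /= ->; rewrite leqNgt lt_cb.
Qed.

Lemma card_set_partitions3 :
  #|set_partitions3 n| = #|[set d in open_diagrams3 n | semi_arcs d == set0]|.
Proof.
rewrite -(card_in_imset (f := @diagram_of_partition n)); last first.
  move=> P Q; rewrite !inE => /andP[partP _] /andP[partQ _] eqPQ.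
  by rewrite -(diagram_of_partitionK partP) eqPQ diagram_of_partitionK.
apply: eq_card => d; apply/imsetP/idP => [[P]|].
  rewrite inE => /andP[partP nestP] ->.
  by rewrite !inE diagram_of_partition_open // nestP eqxx.
rewrite !inE => /andP[/andP[open_d nest_d] /eqP no_semi].
exists (partition_of_diagram d); last by rewrite partition_of_diagramK.
by rewrite inE partition_of_diagramP // partition_of_diagramK.
Qed.

Lemma diagram_label_eq0 d : (diagram_label d == (0, 0)) = (semi_arcs d == set0).
Proof.
rewrite -pair_eqE /= cards_eq0; case: eqP => //= no_semi.
by rewrite cards_eq0 -subset0 -no_semi; apply/subsetP => a; rewrite inE => /andP[].
Qed.

End Partitions.

Theorem theorem2 :
  (forall n : nat,
     #|open_diagrams3 n| = size (tree_level (0, 0) rule3 n)) /\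
  (forall n : nat,
     #|set_partitions3 n| = count_mem (0, 0) (tree_level (0, 0) rule3 n)).
Proof.
split=> n; first by rewrite -(perm_size (perm_labels n)) size_map -cardE.
rewrite -(permP (perm_labels n)) count_map card_set_partitions3 cardE -size_filter.
apply/perm_size/uniq_perm => [||d]; [exact: enum_uniq | exact/filter_uniq/enum_uniq |].
by rewrite mem_enum inE mem_filter mem_enum /= diagram_label_eq0 andbC.
Qed.
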